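(* Let $1\le s<n$ be integers, $m>0$, $\mu>0$, $\varepsilon>0$, and let $\mathcal{C}'$ denote the class of all subsets of $\{1,\dots,n\}$ with cardinality either $s-1$ or $s$. Suppose there are an adaptive sensing procedure satisfying the precision budget $\mathbb{E}_S\big(\sum_j\Gamma_j\big)\le m$ for every $S\in\mathcal{C}'$ and an estimator $\hat S$ such that $\max_{S\in\mathcal{C}'}\mathbb{E}_S(|\hat S\triangle S|)\le\varepsilon$. Then necessarily $$\mu \geq \sqrt{\frac{2(n-s)}{m} \left( \log s + \log\frac{n-s}{n+1} + \log\frac{1}{2\varepsilon} \right)}$$ (the bound being void if the expression under the square root is negative).
   Context: Sensing model. For an unknown support set $S\subseteq\{1,\dots,n\}$ and $\mu>0$, the signal $\boldsymbol{x}\in\mathbb{R}^n$ has $x_i=\mu$ if $i\in S$ and $x_i=0$ otherwise. One collects measurements $Y_j=x_{A_j}+\Gamma_j^{-1/2}W_j$, $j=1,2,\dots$, where $A_j\in\{1,\dots,n\}$ is the measured coordinate, $\Gamma_j>0$ is the precision, and the $W_j$ are i.i.d. $\mathcal{N}(0,1)$, with $W_j$ independent of $\{A_i,\Gamma_i\}_{i\le j}$ and of the past observations. An adaptive sensing procedure chooses $(A_j,\Gamma_j)$ as a (possibly randomized) function of $\{Y_i,A_i,\Gamma_i\}_{i<j}$, and may stop at a data-dependent time (sums over $j$ run over the measurements actually made). An estimator $\hat S\subseteq\{1,\dots,n\}$ is a function of all collected data. $\mathbb{P}_S,\mathbb{E}_S$ denote probability and expectation when the support is $S$. $\triangle$ is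 symmetric difference. *)

(* Defs.v *)
From HB Require Import structures.
From mathcomp Require Import all_boot all_order all_algebra.
From mathcomp Require Import all_classical all_reals all_analysis.
Import Order.TTheory GRing.Theory Num.Theory.
Import numFieldNormedType.Exports.

Set Implicit Arguments.
Unset Strict Implicit.
Unset Printing Implicit Defensive.

Local Open Scope classical_set_scope.
Local Open Scope ring_scope.

(* A measurement (A_j, Gamma_j, Y_j). The coordinate A_j : 'I_n is recorded
   through its value in nat, since measurable types have to be pointed and
   'I_0 is empty. *)
Notation measurement R := (nat * R * R)%type.

Definition precision_of (R : realType) (o : measurement R) : R := o.1.2.

(* Randomization enters through a seed in T, which is available at every step,
   together with the j measurements collected so far: the procedure first
   decides whether to stop; if it does not, it selects the next coordinate and
   precision (whose values after a decision to stop are irrelevant). Nothing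
   forces the procedure to stop. *)
Record procedure (R : realType) (n : nat) (dT : measure_display)
    (T : measurableType dT) := Procedure {
  stops : forall j : nat, T * j.-tuple (measurement R) -> bool ;
  coordinate : forall j : nat, T * j.-tuple (measurement R) -> 'I_n ;
  precision : forall j : nat, T * j.-tuple (measurement R) -> R ;
  measurable_stops : forall j, measurable_fun setT (@stops j) ;
  measurable_coordinate : forall j,
    measurable_fun setT (fun h => nat_of_ord (@coordinate j h)) ;
  measurable_precision : forall j, measurable_fun setT (@precision j) ;
  precision_gt0 : forall j h, 0 < @precision j h }.

Section SensingModel.
Context (R : realType) (n : nat) (dT : measure_display) (T : measurableType dT).
Implicit Types (p : procedure R n T) (x : 'I_n -> R) (u : T) (w : nat -> R).

Definition signal (mu : R) (S : {set 'I_n}) : 'I_n -> R :=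
  fun i => if i \in S then mu else 0.

(* The first k measurements of the signal x, when the seed is u and the noise
   is w; None if the procedure stops before making k measurements. Measurements
   are numbered from 0, and w k is the noise of the measurement number k. *)
Fixpoint history p x u w (k : nat) : option (k.-tuple (measurement R)) :=
  match k return option (k.-tuple (measurement R)) with
  | 0 => Some [tuple]
  | k'.+1 =>
    if history p x u w k' is Some h then
      if stops p (u, h) then None else
      let a := coordinate p (u, h) in
      let g := precision p (u, h) in
      Some [tuple of rcons h (nat_of_ord a, g, x a + (Num.sqrt g)^-1 * w k')]
    else None
  end.

(* All the collected data: the measurement number k, or None if the procedure
   stops before making it. *)
Definition data p x u w : nat -> option (measurement R) :=
  fun k => omap (fun h : k.+1.-tuple (measurement R) => tnth h ord_max)
                (history p x u w k.+1).

Definition total_precision (D : nat -> option (measurement R)) : \bar R :=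
  (\sum_(0 <= k <oo) (oapp (@precision_of R) 0 (D k))%:E)%E.

(* The sigma-algebra <<s data_cylinders >> is the one generated by the
   individual measurements (including whether they are made). *)
Definition data_cylinders : set (set (nat -> option (measurement R))) :=
  [set C | exists k (B : set (measurement R)), measurable B /\
    C = [set D | exists2 o, D k = Some o & B o]].

Definition measurable_estimator
    (Shat : (nat -> option (measurement R)) -> {set 'I_n}) : Prop :=
  forall S : {set 'I_n}, <<s data_cylinders >> (Shat @^-1` [set S]).

Definition symdiff (A B : {set 'I_n}) : {set 'I_n} :=
  ((A :\: B) :|: (B :\: A))%SET.

Definition support_class (s : nat) : {set {set 'I_n}} :=
  [set S : {set 'I_n} | (#|S| == (s - 1)%N) || (#|S| == s)]%SET.

Section Probability.
Context (d : measure_display) (Omega : measurableType d)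
  (P : probability Omega R) (U : {RV P >-> T}) (W : nat -> {RV P >-> R}).

(* The W_j are standard normal, and the variables U, W_0, W_1, ... are
   mutually independent. Since the factors can be set to the whole space, the
   product rule below covers all finite subfamilies. *)
Definition noise_model : Prop :=
  (forall j A, measurable A -> distribution P (W j) A = normal_prob 0 1 A) /\
  (forall (k : nat) (B : set T) (A : nat -> set R),
     measurable B -> (forall j, measurable (A j)) ->
     P (U @^-1` B `&` \bigcap_(j in [set j | (j < k)%N]) (W j @^-1` A j)) =
     (P (U @^-1` B) * \prod_(j < k) P (W j @^-1` A j))%E).

(* The data collected when the support is S; its law under P is that of the
   data under P_S, so E_S is the P-expectation of functions of it. *)
Definition data_at p (mu : R) (S : {set 'I_n}) (omega : Omega) :
    nat -> option (measurement R) :=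
  data p (signal mu S) (U omega) (fun j => W j omega).

Definition expected_precision p (mu : R) (S : {set 'I_n}) : \bar R :=
  (\int[P]_omega total_precision (data_at p mu S omega))%E.

Definition expected_error p (mu : R)
    (Shat : (nat -> option (measurement R)) -> {set 'I_n})
    (S : {set 'I_n}) : \bar R :=
  ('E_P[fun omega => #|symdiff (Shat (data_at p mu S omega)) S|%:R])%E.

End Probability.
End SensingModel.

Arguments support_class : clear implicits.

(* Main.v *)
(* Let S have s - 1 elements and let i be outside S. With the seed and the noise
   fixed, the data under S + i are those under S for a noise shifted predictably
   by mu sqrt(Gamma_j) when A_j = i. Girsanov's formula for such shifts gives the
   likelihood ratio, and the relative entropy of the two laws is mu^2/2 times the
   expected precision G_i spent by S on coordinate i. Hence, for every a >= 0,
     P_S(i in Shat) + P_{S+i}(i notin Shat) >= (1 + a - mu^2 G_i / 2) e^{-a} / 2,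
   first for events that depend on finitely many measurements and then, by
   approximation, for all events. The G_i add up to at most m over the
   N = n - s + 1 elements i outside S, so summing over i with a = mu^2 m / (2 N)
   gives at least N e^{-a} / 2. Summing over S as well, the left-hand side is at
   most (C(n,s-1) + C(n,s)) eps, whence s N e^{-a} <= 2 (n + 1) eps. *)

Require Import Defs.
From HB Require Import structures.
From mathcomp Require Import all_boot all_order all_algebra.
From mathcomp Require Import all_classical all_reals all_analysis.
From mathcomp Require Import measurable_realfun ring lra.
Import Order.TTheory GRing.Theory Num.Theory.
Import numFieldNormedType.Exports.

Set Implicit Arguments.
Unset Strict Implicit.
Unset Printing Implicit Defensive.

Local Open Scope classical_set_scope.
Local Open Scope ring_scope.

(** * Gaussian integrals *)

Section Gaussian.
Context (R : realType).
Local Open Scope ereal_scope.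
Notation N01 := (normal_prob (0:R)%R (1:R)%R).
Notation lambda := (@lebesgue_measure R).
Implicit Types f : R -> \bar R.

(** The Radon-Nikodym derivative of the normal law and its density have the same integral over every
    measurable set, hence agree almost everywhere. *)
Lemma ge0_integral_normal (m sigma : R) (f : R -> \bar R) :
  measurable_fun [set: R] f -> (forall x, 0 <= f x) ->
  \int[normal_prob m sigma]_x f x =
  \int[lambda]_x (f x * (normal_pdf m sigma x)%:E).
Proof.
move=> mf f0; have dom := normal_prob_dominates m sigma.
rewrite -(Radon_Nikodym_SigmaFinite.change_of_variables dom)//.
have mpdf : measurable_fun setT (EFin \o normal_pdf m sigma).
  by apply/measurable_EFinP; exact: measurable_normal_pdf.
apply: ae_eq_integral => //.
- apply: emeasurable_funM => //.
  exact: measurable_int (Radon_Nikodym_SigmaFinite.f_integrable dom).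
- exact: emeasurable_funM.
- apply: ae_eqe_mul2l; apply: integral_ae_eq => //.
  + exact: Radon_Nikodym_SigmaFinite.f_integrable.
  + by move=> A _ mA; rewrite -Radon_Nikodym_SigmaFinite.f_integral.
Qed.

(** The image of Lebesgue measure under a translation gives every half-open interval its length, so
    it is Lebesgue measure by uniqueness. *)
Lemma ge0_integral_lebesgue_shift (a : R) (f : R -> \bar R) :
  measurable_fun [set: R] f -> (forall x, 0 <= f x) ->
  \int[lambda]_x f (x + a)%R = \int[lambda]_x f x.
Proof.
move=> mf f0.
pose shift := (fun x => (x + a)%R) : measurableTypeR R -> measurableTypeR R.
have mshift : measurable_fun setT shift by exact: measurable_funD.
rewrite -(ge0_integral_pushforward mshift lambda measurableT mf)//.
apply: eq_measure_integral => A mA _; apply/esym.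
apply: (@lebesgue_measure_unique R (pushforward lambda shift)) => //.
move=> _ [[b c] _ <-]; transitivity (lambda `](b - a)%R, (c - a)%R]); last first.
  rewrite /pushforward; congr (lambda _); apply/seteqP.
  by split => x /=; rewrite /shift !in_itv/= ltrBlDr lerBrDr.
rewrite !lebesgue_measure_itv/= !lte_fin ltrD2r.
by case: ifP => // _; rewrite -!EFinB; congr (_%:E); ring.
Qed.

Lemma normal_pdf01E (x : R) : normal_pdf 0 1 x =
  (normal_peak 1 * expR (- (x ^+ 2 / 2)))%R.
Proof.
by rewrite normal_pdfE ?oner_eq0// /normal_fun subr0 expr1n mulNr.
Qed.

(** The one-dimensional Cameron-Martin formula: translation invariance reduces it to completing the
    square in the exponent. *)
Lemma ge0_integral_normal_shift (a : R) f :
  measurable_fun [set: R] f -> (forall x, 0 <= f x) ->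
  \int[N01]_x f (x + a)%R =
  \int[N01]_x (f x * (expR (a * x - a ^+ 2 / 2))%:E).
Proof.
move=> mf f0.
have m1 : measurable_fun setT (fun x : R => f (x + a)%R).
  by apply: measurableT_comp => //; exact: measurable_funD.
have me : measurable_fun setT (fun x : R => (expR (a * x - a ^+ 2 / 2))%:E).
  apply/measurable_EFinP; apply: measurableT_comp => //.
  by apply: measurable_funB => //; exact: measurable_funM.
rewrite !ge0_integral_normal ?oner_eq0//; last 2 first.
- exact: emeasurable_funM.
- by move=> x; rewrite mule_ge0// lee_fin expR_ge0.
pose g x := f x * (expR (a * x - a ^+ 2 / 2))%:E * (normal_pdf 0 1 x)%:E.
transitivity (\int[lambda]_x g (x + a)%R); last first.
  apply: ge0_integral_lebesgue_shift => [|x].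
    apply: emeasurable_funM; first exact: emeasurable_funM.
    by apply/measurable_EFinP; exact: measurable_normal_pdf.
  by rewrite !mule_ge0// lee_fin ?expR_ge0// normal_pdf_ge0.
apply: eq_integral => x _; rewrite /g -muleA -EFinM; congr (_ * _%:E).
rewrite !normal_pdf01E mulrCA -expRD; congr (_ * expR _)%R; by field.
Qed.

Lemma ge0_integral_normal_opp f :
  measurable_fun [set: R] f -> (forall x, 0 <= f x) ->
  \int[N01]_x f (- x)%R = \int[N01]_x f x.
Proof.
move=> mf f0.
have mN : measurable_fun setT (-%R : measurableTypeR R -> measurableTypeR R).
  exact: oppr_measurable.
have mfN : measurable_fun setT (fun x : R => f (- x)%R).
  exact: measurableT_comp.
have mpdf : measurable_fun setT (EFin \o normal_pdf (0:R) 1).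
  by apply/measurable_EFinP; exact: measurable_normal_pdf.
rewrite !ge0_integral_normal ?oner_eq0//.
pose g x := f x * (normal_pdf 0 1 x)%:E.
have mg : measurable_fun [set: R] g by exact: emeasurable_funM.
transitivity (\int[lambda]_x g (- x)%R).
  by apply: eq_integral => x _; rewrite /g !normal_pdf01E sqrrN.
transitivity (\int[pushforward lambda (-%R : R -> measurableTypeR R)]_x g x).
  apply: esym; apply: (ge0_integral_pushforward mN lambda measurableT mg).
  by move=> y _; rewrite mule_ge0// lee_fin normal_pdf_ge0.
by apply: eq_measure_integral => A mA _; exact: lebesgue_measureN.
Qed.

(** The mean of the positive part of a standard normal. Only its finiteness is used: it occurs on
    both sides in [testing_bound] and cancels. *)
Definition gauss_pos := \int[N01]_x (Num.max x 0)%:E.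

Lemma gauss_pos_opp : \int[N01]_x (Num.max (- x) 0)%:E = gauss_pos.
Proof.
apply: (@ge0_integral_normal_opp (fun x => (Num.max x 0)%:E)).
  by apply/measurable_EFinP; exact: measurable_maxr.
by move=> x; rewrite lee_fin le_max lexx orbT.
Qed.

Lemma gauss_pos_fin : gauss_pos \is a fin_num.
Proof.
rewrite ge0_fin_numE; last first.
  by apply: integral_ge0 => x _; rewrite lee_fin le_max lexx orbT.
have me : measurable_fun setT (fun x : R => (expR (1 * x - 1 ^+ 2 / 2))%:E).
  apply/measurable_EFinP; apply: measurableT_comp => //.
  by apply: measurable_funB => //; exact: measurable_funM.
(* The positive part of [x] is at most [e^x], which is [e^(1/2)] times [e^(x - 1/2)]. The latter is
   the likelihood ratio of a shift by 1 and integrates to 1. *)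
apply: (@le_lt_trans _ _ (\int[N01]_x ((expR (1 / 2))%:E *
  (expR (1 * x - 1 ^+ 2 / 2))%:E))).
  apply: ge0_le_integral => //.
  - by move=> x _; rewrite lee_fin le_max lexx orbT.
  - by apply/measurable_EFinP; exact: measurable_maxr.
  - by apply: emeasurable_funM => //; exact: measurable_cst.
  - move=> x _; rewrite -EFinM lee_fin -expRD.
    rewrite ge_max expR_ge0 andbT.
    rewrite (_ : (1 / 2 + (1 * x - 1 ^+ 2 / 2) = x)%R); last by field.
    by have := expR_ge1Dx x; lra.
rewrite ge0_integralZl//.
have <- : \int[N01]_x (cst 1 (x + 1)%R) = \int[N01]_x
  (expR (1 * x - 1 ^+ 2 / 2))%:E.
  rewrite (@ge0_integral_normal_shift 1 (cst 1))//.
  by apply: eq_integral => x _; rewrite mul1e.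
rewrite integral_cst// [X in _ * (_ * X)](_ : _ = 1);
  last exact: (@probability_setT _ _ _ N01).
by rewrite mul1e mule1 ltry.
Qed.

End Gaussian.

(** * The space of seeds and noises *)

Section NoiseSpace.
Context (R : realType) (dT : measure_display) (T : measurableType dT).

Definition cylinder (K : nat) (B : set T) (A : nat -> set R) :
    set (T * (nat -> R)) :=
  [set c | B c.1 /\ forall j, (j < K)%N -> A j (c.2 j)].

Definition cylinders : set (set (T * (nat -> R))) :=
  [set X | exists K (B : set T) (A : nat -> set R), [/\ measurable B,
    forall j, measurable (A j) &
    X = cylinder K B A]].

(** The product sigma-algebra on seeds and noise sequences. On this space the data are a
    deterministic function, and all randomness lies in a law [nu]. *)
Definition noise_space : measurableType cylinders.-sigma :=
  g_sigma_algebraType cylinders.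

(** The shorter cylinder is padded with [setT] up to the larger length. Cylinders thus form a
    pi-system, as uniqueness of measures requires. *)
Lemma cylinders_setI : setI_closed cylinders.
Proof.
move=> _ _ [K [B [A [mB mA ->]]]] [K' [B' [A' [mB' mA' ->]]]].
exists (maxn K K'), (B `&` B'), (fun j => (if (j < K)%N then A j else setT) `&`
  (if (j < K')%N then A' j else setT)); split.
- exact: measurableI.
- by move=> j; apply: measurableI; case: ifP.
- apply/seteqP; split => -[u w] /=.
    move=> [[Bu Aw] [B'u A'w]]; split => // j _; split.
      by case: ifP => // /Aw.
    by case: ifP => // /A'w.
  move=> [[Bu B'u] H]; split; split => // j jK.
    by have := H j; rewrite leq_max jK => /(_ isT)[].
  by have := H j; rewrite leq_max jK orbT => /(_ isT)[].
Qed.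

Lemma cylinders_setT : cylinders setT.
Proof.
exists 0%N, setT, (fun=> setT); split => //.
by apply/seteqP; split.
Qed.

Lemma measurable_seed : measurable_fun setT (fst : noise_space -> T).
Proof.
move=> _ B mB; rewrite setTI; apply: sub_sigma_algebra.
exists 0%N, B, (fun=> setT); split => //.
by apply/seteqP; split => [c Bc|c []//]; split.
Qed.

Lemma measurable_noise j : measurable_fun setT (fun c : noise_space => c.2 j).
Proof.
move=> _ A mA; rewrite setTI; apply: sub_sigma_algebra.
exists j.+1, setT, (fun i => if i == j then A else setT); split => //.
  by move=> i; case: ifP.
apply/seteqP; split => [c Ac|c [_ /(_ j (ltnSn j))]]; last by rewrite eqxx.
by split => // i _; case: ifP => // /eqP ->.
Qed.

Lemma measurable_fun_noise_space d (X : measurableType d) (f : X -> noise_space) :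
  measurable_fun setT (fun x => (f x).1) ->
  (forall j, measurable_fun setT (fun x => (f x).2 j)) ->
  measurable_fun setT f.
Proof.
move=> mf1 mf2; apply: (@measurability _ _ _ _ setT f cylinders) => //.
move=> _ [_ [K [B [A [mB mA ->]]]] <-]; rewrite setTI.
rewrite (_ : _ @^-1` _ = (fun x => (f x).1) @^-1` B `&`
    \bigcap_(j in [set j | (j < K)%N]) (fun x => (f x).2 j) @^-1` A j); last first.
  by apply/seteqP; split => x /= [? H]; split => // j; exact: H.
apply: measurableI.
  by rewrite -[X in measurable X]setTI; exact: mf1.
apply: bigcap_measurableType => j _.
by rewrite -[X in measurable X]setTI; exact: mf2.
Qed.

Definition upd (c : noise_space) (k : nat) (v : R) : noise_space :=
  (c.1, fun j => if j == k then v else c.2 j).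

Lemma measurable_upd d (X : measurableType d) (g : X -> noise_space) (k : nat)
    (v : X -> R) :
  measurable_fun setT g -> measurable_fun setT v ->
  measurable_fun setT (fun x => upd (g x) k (v x)).
Proof.
move=> mg mv; apply: measurable_fun_noise_space => /=.
  exact: (measurableT_comp measurable_seed).
move=> j; case: eqP => // _.
exact: (measurableT_comp (measurable_noise j)).
Qed.

Lemma upd_upd (c : noise_space) k v v' : upd (upd c k v) k v' = upd c k v'.
Proof. by congr pair; apply/funext => j /=; case: eqP. Qed.

Lemma upd_at (c : noise_space) k v : (upd c k v).2 k = v.
Proof. by rewrite /= eqxx. Qed.

End NoiseSpace.

(** * Resampling one noise variable *)

Section Resampling.
Local Open Scope ereal_scope.
Context (R : realType) (dT : measure_display) (T : measurableType dT).
Notation C := (noise_space R T).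
Notation N01 := (normal_prob (0:R)%R (1:R)%R).
Variable nu : probability C R.
(** The noises are independent standard normals, independent of the seed. The set [cylinder 0 B A]
    depends on [B] alone, so its measure is the law of the seed, which is arbitrary. *)
Hypothesis nu_cylinder : forall (K : nat) (B : set T) (A : nat -> set R),
  measurable B -> (forall j, measurable (A j)) ->
  nu (cylinder K B A) = nu (cylinder 0 B A) * \prod_(j < K) N01 (A j).

Let measurable_cylinder K (B : set T) (A : nat -> set R) :
  measurable B -> (forall j, measurable (A j)) ->
  measurable (cylinder K B A : set C).
Proof.
by move=> mB mA; apply: sub_sigma_algebra; exists K, B, A.
Qed.

(** Replacing noise [k] by a fresh standard normal preserves [nu]: the image of the product measure
    under the replacement agrees with [nu] on cylinders, a generating pi-system. *)
Lemma ge0_integral_resample k (f : C -> \bar R) :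
  measurable_fun setT f -> (forall c, 0 <= f c) ->
  \int[nu]_c f c = \int[nu]_c \int[N01]_v f (upd c k v).
Proof.
move=> mf f0.
pose phi (cv : C * measurableTypeR R) : C := upd cv.1 k cv.2.
have mphi : measurable_fun setT phi by exact: measurable_upd.
have <- : \int[(nu \x N01)]_cv (f \o phi) cv = \int[nu]_c \int[N01]_v f (upd c k v).
  rewrite (fubini_tonelli1 (f \o phi))//; first exact: measurableT_comp.
  by move=> x; exact: f0.
transitivity (\int[pushforward (nu \x N01) phi]_c f c); last first.
  exact: (ge0_integral_pushforward mphi (nu \x N01) measurableT mf).
apply: eq_measure_integral => S mS _.
apply: (@measure_unique _ R C (@cylinders R dT T) (fun=> setT)) => //.
- exact: cylinders_setI.
- by move=> _; exact: cylinders_setT.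
- by rewrite bigcup_const//; exists 0%N.
- move=> _ [K [B [A [mB mA ->]]]].
  (* [A'] frees coordinate [k]. If [k < K], its constraint passes to the fresh variable; otherwise
     the cylinder does not see coordinate [k]. *)
  pose A' j : set R := if j == k then setT else A j.
  have mA' j : measurable (A' j) by rewrite /A'; case: ifP.
  have [kK|Kk] := ltnP k K.
    transitivity ((nu \x N01) (cylinder K B A' `*` A k)); last first.
      congr (_ _); apply: esym.
      apply/seteqP; split => -[[u w] v] /=.
        move=> [Bu H]; split; last by have := H _ kK; rewrite /= eqxx.
        by split => // j jK; have := H _ jK; rewrite /A' /=; case: ifP.
      move=> [[Bu H] Av]; split => // j jK.
      by have := H _ jK; rewrite /A' /=; case: (eqVneq j k) => [->|].
    rewrite product_measure1E; [|exact: measurable_cylinder|exact: mA].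
    etransitivity; first exact: (nu_cylinder K mB mA).
    transitivity (nu (cylinder K B A') * N01 (A k)); last by [].
    rewrite (nu_cylinder K mB mA') -muleA.
    have -> : cylinder 0 B A' = cylinder 0 B A by apply/seteqP; split => c [].
    congr (_ * _).
    rewrite (bigD1 (Ordinal kK))//= muleC [in RHS](bigD1 (Ordinal kK))//=.
    rewrite /A' eqxx [X in X * _ * _](_ : _ = 1);
      last exact: (@probability_setT _ _ _ N01).
    rewrite mul1e; congr (_ * _).
    by apply: eq_bigr => j /negbTE; rewrite -val_eqE/= => ->.
  transitivity ((nu \x N01) (cylinder K B A `*` setT)); last first.
    congr (_ _); apply: esym.
    apply/seteqP; split => -[[u w] v] /= [].
      move=> Bu H; split => //; split => // j jK; have := H _ jK.
      by rewrite /= ltn_eqF// (leq_trans jK).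
    move=> [Bu H] _; split => // j jK; have := H _ jK.
    by rewrite /= ltn_eqF// (leq_trans jK).
  rewrite product_measure1E; [|exact: measurable_cylinder|by []].
  by rewrite [X in _ = _ * X](_ : _ = 1) ?mule1//; exact:
    (@probability_setT _ _ _ N01).
- by move=> _; rewrite -ge0_fin_numE// fin_num_measure.
Qed.

End Resampling.

(** * Change of measure *)

(* Linearized form of the bound of Bretagnolle and Huber: b is the indicator of
   an event A and l the log-likelihood ratio of Q with respect to P, so that
   integrating gives e^-c (1 + c - KL(P, Q)) / 2 <= P(A) + Q(~A). *)
Lemma likelihood_tangent (R : realType) (c l : R) (b : bool) :
  expR (- c) * (1 + (l + c) / 2) <=
  (b%:R + expR l * (~~ b)%:R) + expR (- c) / 4 * (1 + expR l).
Proof.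
set r := expR (- c); pose y := expR ((l + c) / 2).
have r0 : 0 < r by exact: expR_gt0.
have y0 : 0 < y by exact: expR_gt0.
have -> : expR l = r * y ^+ 2.
  by rewrite /r /y -expRM_natl -expRD; congr expR; lra.
apply: (@le_trans _ _ (r * y)).
  by rewrite ler_pM2l//; exact: expR_ge1Dx.
(* Each case is a square: [(1 - r y / 2)^2 >= 0] if the event holds, [r (y - 1/2)^2 >= 0] if it
   fails. *)
case: b => /=.
- rewrite mulr0 addr0; have := sqr_ge0 (1 - r * y / 2).
  nra.
- rewrite mulr1 add0r; have := mulr_ge0 (ltW r0) (sqr_ge0 (y - 1 / 2)).
  have := sqr_ge0 (r * y).
  nra.
Qed.

Section Girsanov.
Local Open Scope ereal_scope.
Context (R : realType) (dT : measure_display) (T : measurableType dT).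
Notation C := (noise_space R T).
Notation N01 := (normal_prob (0:R)%R (1:R)%R).
Variable nu : probability C R.
Hypothesis nu_cylinder : forall (K : nat) (B : set T) (A : nat -> set R),
  measurable B -> (forall j, measurable (A j)) ->
  nu (cylinder K B A) = nu (cylinder 0 B A) * \prod_(j < K) N01 (A j).

(* theta does not depend on coordinate k, so after resampling this coordinate
   the shift is that of a one-dimensional Gaussian. *)
Lemma ge0_integral_shift k (theta : C -> R) (f : C -> \bar R) :
  measurable_fun setT theta -> (forall c v, theta (upd c k v) = theta c) ->
  measurable_fun setT f -> (forall c, 0 <= f c) ->
  \int[nu]_c f (upd c k (c.2 k + theta c)%R) =
  \int[nu]_c (f c * (expR (theta c * c.2 k - theta c ^+ 2 / 2))%:E).
Proof.
move=> mtheta thetaE mf f0.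
have mk := @measurable_noise R _ T k.
have me : measurable_fun setT
    (fun c : C => (expR (theta c * c.2 k - theta c ^+ 2 / 2))%:E).
  apply/measurable_EFinP; apply: measurableT_comp => //.
  apply: measurable_funB; first exact: measurable_funM.
  by apply: measurable_funM => //; exact: measurable_funX.
rewrite (ge0_integral_resample nu_cylinder k)//; last first.
  apply: measurableT_comp => //; apply: measurable_upd => //.
  exact: measurable_funD.
rewrite [RHS](ge0_integral_resample nu_cylinder k)//; last 2 first.
- exact: emeasurable_funM.
- by move=> c; rewrite mule_ge0// lee_fin expR_ge0.
apply: eq_integral => c _.
transitivity (\int[N01]_v f (upd c k (v + theta c)%R)).
  by apply: eq_integral => v _; rewrite upd_upd upd_at thetaE.
etransitivity.
  apply: (@ge0_integral_normal_shift _ (theta c) (fun v => f (upd c k v))) => //.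
  by apply: measurableT_comp => //; exact: measurable_upd.
by apply: eq_integral => v _; rewrite upd_at thetaE.
Qed.

(** As [theta] ignores coordinate [k], it is independent of noise [k], and the expectation of the
    product factorizes. *)
Lemma ge0_integral_mul_noise k (theta : C -> R) (g : R -> R) :
  measurable_fun setT theta -> (forall c v, theta (upd c k v) = theta c) ->
  (forall c, (0 <= theta c)%R) ->
  measurable_fun setT g -> (forall x, (0 <= g x)%R) ->
  \int[nu]_c (theta c * g (c.2 k))%:E =
  \int[nu]_c (theta c)%:E * \int[N01]_v (g v)%:E.
Proof.
move=> mtheta thetaE theta0 mg g0.
have mk := @measurable_noise R _ T k.
rewrite (ge0_integral_resample nu_cylinder k)//; last 2 first.
- apply/measurable_EFinP; apply: measurable_funM => //.
  exact: (measurableT_comp mg mk).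
- by move=> c; rewrite lee_fin mulr_ge0.
rewrite -ge0_integralZr//; last 3 first.
- exact/measurable_EFinP.
- by move=> c _; rewrite lee_fin.
- by apply: integral_ge0 => v _; rewrite lee_fin.
apply: eq_integral => c _; rewrite -ge0_integralZl//; last 3 first.
- exact/measurable_EFinP.
- by move=> v _; rewrite lee_fin.
- by rewrite lee_fin.
by apply: eq_integral => v _; rewrite upd_at thetaE.
Qed.

Variable theta : nat -> C -> R.
Hypothesis mtheta : forall k, measurable_fun setT (theta k).
Hypothesis theta_ge0 : forall k c, (0 <= theta k c)%R.
Hypothesis theta_predictable : forall k (c c' : C), c.1 = c'.1 ->
  (forall j, (j < k)%N -> c.2 j = c'.2 j) -> theta k c = theta k c'.

(** The shift [theta k] is evaluated at the sequence whose first [k] entries are already shifted, as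
    a procedure reacts to the past that it has actually observed. *)
Fixpoint drift (K : nat) (c : C) : C :=
  if K is k.+1 then upd (drift k c) k ((drift k c).2 k + theta k (drift k c))%R
  else c.

(** The logarithm of the Girsanov density, with respect to [nu], of the image of [nu] under
    [drift K]. *)
Definition log_likelihood (K : nat) (c : C) : R :=
  (\sum_(j < K) (theta j c * c.2 j - theta j c ^+ 2 / 2))%R.

Lemma theta_upd j k (c : C) v : (j <= k)%N -> theta j (upd c k v) = theta j c.
Proof.
move=> jk; apply: theta_predictable => // i ij /=.
by rewrite ltn_eqF// (leq_trans ij).
Qed.

Lemma log_likelihood_upd K (c : C) v :
  log_likelihood K (upd c K v) = log_likelihood K c.
Proof.
apply: eq_bigr => j _; rewrite theta_upd ?(ltnW (ltn_ord j))//.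
by rewrite /= ltn_eqF.
Qed.

Lemma measurable_drift K : measurable_fun setT (drift K).
Proof.
elim: K => [|K IH] /=; first exact: measurable_id.
apply: measurable_upd => //; apply: measurable_funD.
  exact: (measurableT_comp (@measurable_noise R _ T K)).
exact: measurableT_comp.
Qed.

Lemma measurable_log_likelihood K : measurable_fun setT (log_likelihood K).
Proof.
apply: measurable_sum => j; apply: measurable_funB.
  by apply: measurable_funM => //; exact: measurable_noise.
by apply: measurable_funM => //; exact: measurable_funX.
Qed.

(** Induction on the number of shifts. The likelihood of the first [K] does not see coordinate [K],
    so the last shift can be carried through it and contributes its own factor. *)
Lemma ge0_integral_drift K (f : C -> \bar R) :
  measurable_fun setT f -> (forall c, 0 <= f c) ->
  \int[nu]_c f (drift K c) = \int[nu]_c (f c * (expR (log_likelihood K c))%:E).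
Proof.
elim: K f => [|K IH] f mf f0.
  apply: eq_integral => c _.
  by rewrite /log_likelihood big_ord0 expR0 mule1.
have mL : measurable_fun setT (fun c => (expR (log_likelihood K c))%:E).
  apply/measurable_EFinP; apply: measurableT_comp => //.
  exact: measurable_log_likelihood.
have mshift : measurable_fun setT (fun c : C => upd c K (c.2 K + theta K c)%R).
  by apply: measurable_upd => //; apply: measurable_funD => //; exact: measurable_noise.
etransitivity.
  apply: (IH (fun c => f (upd c K (c.2 K + theta K c)%R))) => //.
  exact: measurableT_comp.
pose h c := f c * (expR (log_likelihood K c))%:E.
transitivity (\int[nu]_c h (upd c K (c.2 K + theta K c)%R)).
  by apply: eq_integral => c _; rewrite /h log_likelihood_upd.
etransitivity.
  apply: (ge0_integral_shift (mtheta K) (fun c v => theta_upd c v (leqnn K))).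
    exact: emeasurable_funM.
  by move=> c; rewrite /h mule_ge0// lee_fin expR_ge0.
apply: eq_integral => c _; rewrite /h -muleA -EFinM -expRD.
by rewrite /log_likelihood big_ord_recr.
Qed.

(** The inequality [likelihood_tangent] is integrated with [c = a]. The likelihood ratio has
    integral 1, and the log-likelihood has mean minus half the sum of the second moments of the
    shifts. *)
Lemma testing_bound K (A : set C) (a : R) : measurable A -> (0 <= a)%R ->
  \sum_(j < K) \int[nu]_c (theta j c ^+ 2)%:E < +oo ->
  (expR (- a) / 2 * (1 + a))%:E <=
  nu A + nu (drift K @^-1` (~` A)) +
  (expR (- a) / 4)%:E * \sum_(j < K) \int[nu]_c (theta j c ^+ 2)%:E.
Proof.
move=> mA a0 sq_fin.
set r := expR (- a); have r0 : (0 <= r)%R by exact: expR_ge0.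
have mk := @measurable_noise R _ T.
have theta_upd_k k (c : C) v : theta k (upd c k v) = theta k c.
  exact: theta_upd.
have msq j : measurable_fun setT (fun c : C => (theta j c ^+ 2)%:E).
  by apply/measurable_EFinP; exact: measurable_funX.
have mth j : measurable_fun setT (fun c : C => (theta j c)%:E).
  exact/measurable_EFinP.
have sq_ge0 j (c : C) : 0 <= (theta j c ^+ 2)%:E by rewrite lee_fin sqr_ge0.
have isq_ge0 j : 0 <= \int[nu]_c (theta j c ^+ 2)%:E by exact: integral_ge0.
have ith_ge0 j : 0 <= \int[nu]_c (theta j c)%:E.
  by apply: integral_ge0 => c _; rewrite lee_fin.
have ith_fin j : (j < K)%N -> \int[nu]_c (theta j c)%:E \is a fin_num.
  move=> jK; rewrite ge0_fin_numE//.
  (* First moments are finite because [theta] is at most [1 + theta ^ 2]. *)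
  apply: (@le_lt_trans _ _ (\int[nu]_c (1 + (theta j c ^+ 2)%:E))).
    apply: ge0_le_integral => //.
    - by move=> c _; rewrite lee_fin.
    - by apply: emeasurable_funD => //; exact: measurable_cst.
    - move=> c _; rewrite -EFinD lee_fin.
      by have := sqr_ge0 (theta j c - 1)%R; have := theta_ge0 j c; nra.
  rewrite ge0_integralD// integral_cst//.
  rewrite [X in _ * X](_ : _ = 1) ?mule1;
    last exact: (@probability_setT _ _ _ nu).
  rewrite lte_add_pinfty ?ltry//.
  apply: le_lt_trans sq_fin.
  by rewrite (bigD1 (Ordinal jK))//= leeDl// sume_ge0.
pose S1 := \sum_(j < K) \int[nu]_c (theta j c)%:E.
pose S2 := \sum_(j < K) \int[nu]_c (theta j c ^+ 2)%:E.
have S1fin : S1 \is a fin_num.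
  by rewrite /S1 sum_fin_num; apply/allP => x /mapP[j _ ->]; exact: ith_fin.
have S2fin : S2 \is a fin_num by rewrite ge0_fin_numE// sume_ge0.
(* The mean of theta_j W_j is 0, but only nonnegative functions are integrated
   here: the positive and negative parts of W_j contribute the same finite
   amount to the two sides. *)
pose part (g : R -> R) j (c : C) : \bar R := (theta j c * g (c.2 j))%:E.
pose pos (x : R) := Num.max x 0%R.
pose neg (x : R) := Num.max (- x)%R 0%R.
have mpos : measurable_fun setT pos by exact: measurable_maxr.
have mneg : measurable_fun setT neg
  by apply: measurable_maxr => //; exact: oppr_measurable.
have pos0 x : (0 <= pos x)%R by rewrite /pos le_max lexx orbT.
have neg0 x : (0 <= neg x)%R by rewrite /neg le_max lexx orbT.
have mpart (g : R -> R) j : measurable_fun setT g -> measurable_fun setT (part g j).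
  move=> mg; apply/measurable_EFinP; apply: measurable_funM => //.
  exact: measurableT_comp.
have part0 (g : R -> R) j (c : C) : (forall x, 0 <= g x)%R -> 0 <= part g j c.
  by move=> g0; rewrite lee_fin mulr_ge0.
have ipart (g : R -> R) : measurable_fun setT g -> (forall x, 0 <= g x)%R ->
    \int[nu]_c (\sum_(j < K) part g j c) = S1 * \int[N01]_v (g v)%:E.
  move=> mg g0; rewrite ge0_integral_sum//; last 2 first.
  - by move=> j; exact: mpart.
  - by move=> j c _; exact: part0.
  rewrite /S1 ge0_sume_distrl//; apply: eq_bigr => j _.
  exact: ge0_integral_mul_noise.
(* The tangent inequality, with negative terms moved across, bounds [F] by the sum of [G1] to [G4].
   [G1] integrates to the two error probabilities, [G2] to [r / 2], and [G3] cancels the noise term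
   of [F]. *)
pose F (c : C) : \bar R := (r * (1 + a / 2))%:E + (r / 2)%:E * \sum_(j < K) part pos j c.
pose L (c : C) : \bar R := (expR (log_likelihood K c))%:E.
have mL : measurable_fun setT L.
  apply/measurable_EFinP; apply: measurableT_comp => //.
  exact: measurable_log_likelihood.
pose G1 (c : C) : \bar R := (\1_A c)%:E + (\1_(~` A) c)%:E * L c.
pose G2 (c : C) : \bar R := (r / 4)%:E * (1 + L c).
pose G3 (c : C) : \bar R := (r / 2)%:E * \sum_(j < K) part neg j c.
pose G4 (c : C) : \bar R := (r / 4)%:E * \sum_(j < K) (theta j c ^+ 2)%:E.
have FG c : F c <= G1 c + G2 c + (G3 c + G4 c).
  have := likelihood_tangent a (log_likelihood K c) (c \in A).
  rewrite /F /G1 /G2 /G3 /G4 /L !indicE in_setC.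
  rewrite !sumEFin -?EFinM -?EFinD -?EFinM -?EFinD lee_fin -/r.
  have : log_likelihood K c = (\sum_(j < K) theta j c * pos (c.2 j) -
     \sum_(j < K) theta j c * neg (c.2 j) - (\sum_(j < K) theta j c ^+ 2) / 2)%R.
    rewrite mulr_suml -!sumrB; apply: eq_bigr => j _; rewrite -mulrBr.
    congr (_ * _ - _)%R; rewrite /pos /neg.
    by case: (leP (c.2 j) 0%R); case: (leP (- c.2 j)%R 0%R); lra.
  move: (log_likelihood _ _) (expR _) => l e ->.
  move: (\sum_(j < K) _)%R (\sum_(j < K) _)%R (\sum_(j < K) _)%R => p n q.
  by lra.
have mF : measurable_fun setT F.
  apply: emeasurable_funD; first exact: measurable_cst.
  by apply: measurable_funeM; apply: emeasurable_sum => j; exact: mpart.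
have mG1 : measurable_fun setT G1.
  apply: emeasurable_funD; last apply: emeasurable_funM => //.
    exact/measurable_EFinP/measurable_indic.
  exact/measurable_EFinP/measurable_indic/measurableC.
have mG2 : measurable_fun setT G2.
  by apply: measurable_funeM; apply: emeasurable_funD => //; exact: measurable_cst.
have mG3 : measurable_fun setT G3.
  by apply: measurable_funeM; apply: emeasurable_sum => j; exact: mpart.
have mG4 : measurable_fun setT G4.
  by apply: measurable_funeM; apply: emeasurable_sum => j; exact: msq.
have L0 c : 0 <= L c by rewrite lee_fin expR_ge0.
have F0 c : 0 <= F c.
  rewrite adde_ge0// ?mule_ge0// ?lee_fin ?mulr_ge0 ?addr_ge0 ?divr_ge0//.
  by apply: sume_ge0 => j _; exact: part0.
have G10 c : 0 <= G1 c by rewrite adde_ge0// ?mule_ge0// lee_fin.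
have G20 c : 0 <= G2 c by rewrite mule_ge0// ?lee_fin ?divr_ge0// adde_ge0.
have G30 c : 0 <= G3 c.
  rewrite mule_ge0// ?lee_fin ?divr_ge0//.
  by apply: sume_ge0 => j _; exact: part0.
have G40 c : 0 <= G4 c.
  rewrite mule_ge0// ?lee_fin ?divr_ge0//.
  by apply: sume_ge0 => j _; exact: sq_ge0.
have iL : \int[nu]_c L c = 1.
  have := ge0_integral_drift K
    (@measurable_cst _ _ C _ setT (1 : \bar R)) (fun=> lee01).
  rewrite integral_cst// mul1e [X in X = _](_ : _ = 1);
    last exact: (@probability_setT _ _ _ nu).
  by move=> ->; apply: eq_integral => c _; rewrite mul1e.
have iF : \int[nu]_c F c = (r * (1 + a / 2))%:E + (r / 2)%:E * (S1 * gauss_pos R).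
  rewrite ge0_integralD//; last 3 first.
  - by move=> c _; rewrite lee_fin mulr_ge0 ?addr_ge0 ?divr_ge0.
  - by move=> c _; rewrite mule_ge0// ?lee_fin ?divr_ge0//
    sume_ge0// => j _; exact: part0.
  - by apply: measurable_funeM; apply: emeasurable_sum => j; exact: mpart.
  rewrite integral_cst// [X in _ * X](_ : _ = 1) ?mule1;
    last exact: (@probability_setT _ _ _ nu).
  rewrite ge0_integralZl//; last 3 first.
  - by apply: emeasurable_sum => j; exact: mpart.
  - by move=> c _; rewrite sume_ge0// => j _; exact: part0.
  - by rewrite lee_fin divr_ge0.
  by rewrite ipart.
have iG1 : \int[nu]_c G1 c = nu A + nu (drift K @^-1` (~` A)).
  have mdA : measurable (drift K @^-1` (~` A)).
    rewrite -[X in measurable X]setTI; apply: measurable_drift => //.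
    exact: measurableC.
  rewrite ge0_integralD//; last 3 first.
  - exact/measurable_EFinP/measurable_indic.
  - by move=> c _; rewrite mule_ge0// lee_fin.
  - apply: emeasurable_funM => //.
    exact/measurable_EFinP/measurable_indic/measurableC.
  rewrite integral_indic// setIT; congr (_ + _).
  rewrite -(ge0_integral_drift K
    (f := fun c => (\1_(~` A) c)%:E))//.
  - by rewrite -[in RHS](setIT (drift K @^-1` _)) -integral_indic.
  - exact/measurable_EFinP/measurable_indic/measurableC.
have iG2 : \int[nu]_c G2 c = (r / 2)%:E.
  rewrite ge0_integralZl//; last 3 first.
  - by apply: emeasurable_funD => //; exact: measurable_cst.
  - by move=> c _; rewrite adde_ge0.
  - by rewrite lee_fin divr_ge0.
  rewrite ge0_integralD// iL integral_cst//
    [X in _ * (_ * X + _)](_ : _ = 1) ?mule1; last exact: (@probability_setT _ _ _ nu).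
  by rewrite -EFinD -EFinM; congr (_%:E); lra.
have iG3 : \int[nu]_c G3 c = (r / 2)%:E * (S1 * gauss_pos R).
  rewrite ge0_integralZl//; last 3 first.
  - by apply: emeasurable_sum => j; exact: mpart.
  - by move=> c _; rewrite sume_ge0// => j _; exact: part0.
  - by rewrite lee_fin divr_ge0.
  by rewrite ipart// gauss_pos_opp.
have iG4 : \int[nu]_c G4 c = (r / 4)%:E * S2.
  rewrite ge0_integralZl//; last 3 first.
  - by apply: emeasurable_sum => j; exact: msq.
  - by move=> c _; rewrite sume_ge0// => j _; exact: sq_ge0.
  - by rewrite lee_fin divr_ge0.
  by rewrite ge0_integral_sum.
have : \int[nu]_c F c <= \int[nu]_c (G1 c + G2 c + (G3 c + G4 c)).
  apply: ge0_le_integral => //.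
  by apply: emeasurable_funD; exact: emeasurable_funD.
rewrite iF ge0_integralD//; last 4 first.
- by move=> c _; exact: adde_ge0.
- exact: emeasurable_funD.
- by move=> c _; exact: adde_ge0.
- exact: emeasurable_funD.
rewrite (ge0_integralD _ measurableT (f1 := G1))//
  (ge0_integralD _ measurableT (f1 := G3))//.
rewrite iG1 iG2 iG3 iG4 -/S2.
have : nu A + nu (drift K @^-1` (~` A)) \is a fin_num.
  rewrite fin_numD !fin_num_measure//.
  rewrite -[X in measurable X]setTI; apply: measurable_drift => //.
  exact: measurableC.
move: S1fin S2fin (gauss_pos_fin R) => /fineK <- /fineK <- /fineK <- /fineK <-.
rewrite -!EFinM -!EFinD !lee_fin.
move: (fine _) (fine _) (fine _) (fine _) => x y z t.
by lra.
Qed.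

End Girsanov.

(** * Approximation by the sets of a generating algebra *)

Section Approximation.
Local Open Scope ereal_scope.
Context d (T : measurableType d) (R : realType).
Variable mu : {measure set T -> \bar R}.
Hypothesis mu_fin : mu setT < +oo.
Variable F : set (set T).
Hypothesis F0 : F set0.
Hypothesis FC : setC_closed F.
Hypothesis FU : setU_closed F.
Hypothesis mF : F `<=` measurable.

Let approximable := [set B | measurable B /\
  forall e : R, (0 < e)%R -> exists2 A, F A & mu (A `+` B) <= e%:E].

Let measurableY (A B : set T) :
  measurable A -> measurable B -> measurable (A `+` B).
Proof. by move=> mA mB; apply: measurableU; exact: measurableD. Qed.

Let approximableU : setU_closed approximable.
Proof.
move=> A B [mA aA] [mB aB]; split; first exact: measurableU.
move=> e e0; have e20 : (0 < e / 2)%R by rewrite divr_gt0.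
have [A' FA' HA] := aA _ e20; have [B' FB' HB] := aB _ e20.
have mA' := mF FA'; have mB' := mF FB'.
exists (A' `|` B'); first exact: FU.
apply: (@le_trans _ _ (mu ((A' `+` A) `|` (B' `+` B)))).
  apply: le_measure; rewrite ?inE.
  - by apply: measurableY; exact: measurableU.
  - by apply: measurableU; exact: measurableY.
  by move=> x [[[?|?] /not_orP[? ?]]|[[?|?] /not_orP[? ?]]];
    [left; left|right; left|left; right|right; right].
apply: (@le_trans _ _ (mu (A' `+` A) + mu (B' `+` B))).
  by apply: measureU2; exact: measurableY.
by apply: le_trans (leeD HA HB) _; rewrite -EFinD lee_fin -splitr.
Qed.

(** The approximable sets form a sigma-algebra: complementation preserves symmetric differences, and
    a countable union is first cut to a finite one. *)
Lemma algebra_approximation (B : set T) : <<s F >> B ->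
  measurable B /\
  forall e : R, (0 < e)%R -> exists2 A, F A & mu (A `+` B) <= e%:E.
Proof.
move=> sB; suff : approximable B by [].
move: B sB; apply: smallest_sub; last first.
  move=> A FA; split => [|e e0]; first exact: mF.
  by exists A => //; rewrite setYK measure0 lee_fin ltW.
split.
- split=> // e e0; exists set0 => //.
  by rewrite setYK measure0 lee_fin ltW.
- move=> A [mA aA]; rewrite setTD; split=> [|e e0]; first exact: measurableC.
  have [A' FA' HA] := aA _ e0; exists (~` A'); first exact: FC.
  rewrite (_ : _ `+` _ = A' `+` A)//.
  apply/seteqP; split => x; rewrite /setY /setD /=;
    have := pselect (A x); have := pselect (A' x); tauto.
- move=> A aA; have mA n : measurable (A n) by have [] := aA n.
  have mU : measurable (\bigcup_n A n) by exact: bigcup_measurable.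
  split=> // e e0; have e20 : (0 < e / 2)%R by rewrite divr_gt0.
  pose U N := \big[setU/set0]_(n < N) A n.
  have mUN N : measurable (U N) by exact: bigsetU_measurable.
  have aU N : approximable (U N).
    elim: N => [|N IH]; rewrite /U ?big_ord0 ?big_ord_recr/=.
      by split=> // e' e'0; exists set0 => //; rewrite setYK measure0 lee_fin ltW.
    exact: approximableU.
  (* The tails decrease to the empty set, so continuity from above, available for a finite measure,
     makes them eventually small. *)
  have [N HN] : exists N, mu (\bigcup_n A n `\` U N) <= (e / 2)%:E.
    pose D N := \bigcup_n A n `\` U N.
    have mD N : measurable (D N) by exact: measurableD.
    have cvgD : mu (D N) @[N --> \oo] --> mu (\bigcap_N D N).
      apply: nonincreasing_cvg_mu => //.
      - by apply: le_lt_trans mu_fin; apply: le_measure; rewrite ?inE.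
      - exact: bigcap_measurableType.
      - by move=> i j ij; apply/subsetPset; apply: setDS; exact: subset_bigsetU.
    have D0 : \bigcap_N D N = set0.
      rewrite -subset0 => x DN; have [[n _ Anx] _] := DN 0%N I.
      have [_] := DN n.+1 I; apply; rewrite /U big_ord_recr /=; right; exact: Anx.
    rewrite D0 measure0 in cvgD.
    apply: contrapT => /forallNP H.
    suff : (e / 2)%:E <= 0 by rewrite lee_fin leNgt e20.
    by apply: (cvge_to_ge cvgD);
      apply: nearW => N; apply/ltW; rewrite ltNge; exact/negP/H.
  have [_ /(_ _ e20)[A' FA' HA]] := aU N; have mA' := mF FA'.
  exists A' => //.
  apply: (@le_trans _ _ (mu ((A' `+` U N) `|` (\bigcup_n A n `\` U N)))).
    apply: le_measure; rewrite ?inE.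
    + exact: measurableY.
    + by apply: measurableU; [exact: measurableY|exact: measurableD].
    + have UA : U N `<=` \bigcup_n A n by exact: bigsetU_bigcup.
      move=> x; rewrite /setY /setD /= => -[[A'x nAx]|[Ax nA'x]].
        by left; left; split => // /UA.
      by have [Ux|nUx] := pselect (U N x); [left; right|right].
  apply: (@le_trans _ _ (mu (A' `+` U N) + mu (\bigcup_n A n `\` U N))).
    by apply: measureU2; [exact: measurableY|exact: measurableD].
  by apply: le_trans (leeD HA HN) _; rewrite -EFinD lee_fin -splitr.
Qed.

End Approximation.

(** * Histories and data *)

Definition precision_at (R : realType) (n : nat) (i : 'I_n) (o : measurement R) : R :=
  if o.1.1 == i :> nat then precision_of o else 0.

Definition data_space (R : realType) :
    measurableType (@data_cylinders R).-sigma :=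
  g_sigma_algebraType (@data_cylinders R).

Section Histories.
Context (R : realType) (n : nat) (dT : measure_display) (T : measurableType dT).
Variable p : procedure R n T.
Implicit Types (x : 'I_n -> R) (u : T) (w : nat -> R).

Lemma dataE x u w k : data p x u w k =
  if history p x u w k is Some h then
    if stops p (u, h) then None else
    let a := coordinate p (u, h) in
    let g := precision p (u, h) in
    Some (nat_of_ord a, g, x a + (Num.sqrt g)^-1 * w k)
  else None.
Proof.
rewrite /data /=; case: (history _ _ _ _ _) => //= h; case: ifP => //= _.
congr Some; set y := (X in rcons _ X).
by rewrite (tnth_nth y) /= nth_rcons size_tuple ltnn eqxx.
Qed.

Lemma eq_history x u w w' k : (forall j, (j < k)%N -> w j = w' j) ->
  history p x u w k = history p x u w' k.
Proof.
elim: k => //= k IH ww'; rewrite IH => [|j jk]; last by rewrite ww'// ltnS ltnW.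
by rewrite ww'.
Qed.

Lemma data_precision_ge0 x u w k :
  0 <= oapp (@precision_of R) 0 (data p x u w k).
Proof.
rewrite dataE; case: (history _ _ _ _ _) => //= h; case: ifP => //= _.
exact/ltW/precision_gt0.
Qed.

Lemma data_precision_at_ge0 x u w k (i : 'I_n) :
  0 <= oapp (precision_at i) 0 (data p x u w k).
Proof.
have := data_precision_ge0 x u w k; case: (data _ _ _ _ _) => //= o o0.
by rewrite /precision_at; case: ifP.
Qed.

(** A measurement concerns a single coordinate, so at most one term is nonzero. *)
Lemma sum_precision_at_le x u w k (A : {set 'I_n}) :
  \sum_(i in A) oapp (precision_at i) 0 (data p x u w k) <=
  oapp (@precision_of R) 0 (data p x u w k).
Proof.
have := data_precision_ge0 x u w k; rewrite dataE.
case: (history _ _ _ _ _) => /= [h|]; last by rewrite big1.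
case: ifP => /= _; first by rewrite big1.
set a := coordinate _ _ => g0; rewrite /precision_at /=.
have [aA|aA] := boolP (a \in A); last first.
  rewrite big1// => i iA; case: eqP => // /val_inj ai.
  by rewrite ai iA in aA.
rewrite (bigD1 a)//= eqxx big1 ?addr0// => i /andP[_].
by rewrite eq_sym -val_eqE/= => /negbTE ->.
Qed.

Section Measurability.
Variable x : 'I_n -> R.
Notation C := (noise_space R T).

(** The signal extended by 0 to [nat], where coordinates are recorded and every function is
    measurable. *)
Let sig (m : nat) : R := oapp x 0 (insub m).

Let sigE (a : 'I_n) : sig a = x a.
Proof. by rewrite /sig valK. Qed.

(** The inverse square root is written as a power so that [measurable_powR] applies; the two agree
    at positive precisions, as used in [historyE]. *)
Let measurement_at (c : C) k (h : k.-tuple (measurement R)) : measurement R :=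
  (nat_of_ord (coordinate p (c.1, h)), precision p (c.1, h),
   sig (coordinate p (c.1, h)) +
     precision p (c.1, h) `^ (- 2^-1) * c.2 k).

(* The history of the procedure that ignores every decision to stop; unlike
   history, it takes values in a fixed measurable type. *)
Fixpoint full_history (c : C) (k : nat) : k.-tuple (measurement R) :=
  if k is k'.+1 then
    [tuple of rcons (full_history c k') (measurement_at c (full_history c k'))]
  else [tuple].

Fixpoint alive (c : C) (k : nat) : bool :=
  if k is k'.+1 then alive c k' && ~~ stops p (c.1, full_history c k') else true.

Lemma historyE (c : C) k :
  history p x c.1 c.2 k = if alive c k then Some (full_history c k) else None.
Proof.
elim: k => //= k ->; case: (alive c k) => //=; case: (stops _ _) => //=.
rewrite /measurement_at sigE powRN -powR12_sqrt//.
exact/ltW/precision_gt0.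
Qed.

Lemma measurable_full_history k : measurable_fun setT (full_history ^~ k).
Proof.
elim: k => [|k IH]; first by apply/measurable_fun_tnthP; case.
have mpair : measurable_fun setT (fun c : C => (c.1, full_history c k)
  : T * k.-tuple (measurement R)).
  by apply: measurable_fun_pair => //; exact: measurable_seed.
have mo : measurable_fun setT (fun c : C => measurement_at c (full_history c k)).
  apply: measurable_fun_pair; first apply: measurable_fun_pair.
  - exact: (measurableT_comp (measurable_coordinate p (j:=k)) mpair).
  - exact: (measurableT_comp (measurable_precision p (j:=k)) mpair).
  - apply: measurable_funD.
      apply: (@measurableT_comp _ _ _ _ _ _ sig) => //.
      exact: (measurableT_comp (measurable_coordinate p (j:=k)) mpair).
    apply: measurable_funM; last exact: measurable_noise.
    apply: (measurableT_comp (measurable_powR _)).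
    exact: (measurableT_comp (measurable_precision p (j:=k)) mpair).
apply/measurable_fun_tnthP => i.
have [ik|ki] := ltnP i k.
  rewrite (_ : _ \o _ = fun c => tnth (full_history c k) (Ordinal ik)).
    exact: (measurableT_comp (@measurable_tnth _ (measurement R) k (Ordinal ik)) IH).
  apply/funext => c /=.
  set y := measurement_at _ _.
  by rewrite !(tnth_nth y)/= nth_rcons size_tuple ik.
rewrite (_ : _ \o _ = fun c => measurement_at c (full_history c k))//.
apply/funext => c /=; set y := measurement_at _ _.
have -> : i = ord_max by apply/val_inj/eqP; rewrite /= eqn_leq ki -ltnS ltn_ord.
by rewrite !(tnth_nth y)/= nth_rcons size_tuple ltnn eqxx.
Qed.

Lemma measurable_alive k : measurable [set c : C | alive c k].
Proof.
elim: k => [|k IH] /=.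
  by rewrite (_ : [set _ | _] = setT)//; apply/seteqP; split.
rewrite (_ : [set _ | _] = [set c | alive c k] `&`
    (fun c : C => stops p (c.1, full_history c k)) @^-1` [set false]); last first.
  apply/seteqP; split => c /=; first by case/andP => -> /negbTE.
  by case=> -> ->.
apply: measurableI => //; rewrite -[X in measurable X]setTI.
apply: (measurableT_comp (measurable_stops p (j:=k))) => //.
by apply: measurable_fun_pair; [exact: measurable_seed|exact: measurable_full_history].
Qed.

Lemma measurable_data :
  measurable_fun setT (fun c : C => data p x c.1 c.2 : data_space R).
Proof.
pose f (c : C) : data_space R := data p x c.1 c.2.
apply: (@measurability _ _ C (data_space R) setT f (@data_cylinders R)) => //.
move=> _ [_ [k [B [mB ->]]] <-]; rewrite setTI.
rewrite (_ : _ @^-1` _ = [set c | alive c k.+1] `&`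
    (fun c => tnth (full_history c k.+1) ord_max) @^-1` B); last first.
  apply/seteqP; split => c; rewrite /preimage /mkset /f /data historyE.
    by case: ifP => [al|_] [y] // [] <- By; split.
  by move=> [-> Bo]; eexists; first reflexivity.
apply: measurableI; first exact: measurable_alive.
rewrite -[X in measurable X]setTI.
have mtnth : measurable_fun setT (fun c : C => tnth (full_history c k.+1) ord_max).
  exact: (measurableT_comp (measurable_tnth ord_max)
    (measurable_full_history (k:=k.+1))).
exact: mtnth.
Qed.

End Measurability.

Lemma measurable_oapp_data (g : measurement R -> R) k :
  measurable_fun setT g ->
  measurable_fun setT (fun D : data_space R => oapp g 0 (D k)).
Proof.
move=> mg _ Y mY; rewrite setTI.
pose cyl (B : set (measurement R)) : set (data_space R) :=
  [set D | exists2 o, D k = Some o & B o].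
have mcyl B : measurable B -> measurable (cyl B).
  by move=> mB; apply: sub_sigma_algebra; exists k, B.
(* The case split is on whether measurement [k] is made; if not, the value is the default 0. *)
rewrite (_ : _ @^-1` _ = cyl (g @^-1` Y) `|` (~` cyl setT `&` [set _ | Y 0])); last first.
  apply/seteqP; split => D; rewrite /preimage /cyl /=; case: (D k) => [y|] /=.
  - by left; exists y.
  - by move=> Y0; right; split => // -[].
  - by case=> [[y' [->]]//|[[]]]; exists y.
  - by case=> [[]//|[]].
apply: measurableU; first by apply: mcyl; rewrite -[X in measurable X]setTI; exact: mg.
apply: measurableI; first by apply: measurableC; exact: mcyl.
have [Y0|nY0] := pselect (Y 0).
  by rewrite (_ : [set _ | _] = setT)//; apply/seteqP; split.
by rewrite (_ : [set _ | _] = set0)//; apply/seteqP; split.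
Qed.

Lemma measurable_precision_at (i : 'I_n) :
  measurable_fun setT (@precision_at R n i).
Proof.
apply: measurable_fun_if => //.
- apply: (@measurableT_comp _ _ _ _ _ _ (fun m : nat => m == i :> nat)) => //.
  exact: measurableT_comp.
- by apply: measurable_funTS; exact: measurableT_comp.
Qed.

End Histories.

(** * Two supports that differ in one coordinate *)

Section ChangeOfSupport.
Context (R : realType) (n : nat) (dT : measure_display) (T : measurableType dT).
Variables (p : procedure R n T) (mu : R).
Hypothesis mu0 : 0 <= mu.
Notation C := (noise_space R T).

Definition data_of (S : {set 'I_n}) (c : C) : data_space R :=
  data p (signal mu S) c.1 c.2.

Definition mean_shift (S : {set 'I_n}) (i : 'I_n) (k : nat) (c : C) : R :=
  mu * Num.sqrt (oapp (precision_at i) 0 (data_of S c k)).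

Lemma measurable_data_of S : measurable_fun setT (data_of S).
Proof. exact: measurable_data. Qed.

Lemma measurable_mean_shift S i k : measurable_fun setT (mean_shift S i k).
Proof.
have -> : mean_shift S i k =
    fun c => mu * (oapp (precision_at i) 0 (data_of S c k) `^ 2^-1).
  apply/funext => c; rewrite /mean_shift powR12_sqrt//.
  exact: data_precision_at_ge0.
apply: measurable_funM => //; apply: (measurableT_comp (measurable_powR _)).
apply: (measurableT_comp (measurable_oapp_data k (@measurable_precision_at R n i))).
exact: measurable_data_of.
Qed.

Lemma mean_shift_ge0 S i k c : 0 <= mean_shift S i k c.
Proof. by rewrite mulr_ge0// sqrtr_ge0. Qed.

(** The decision to make measurement [k], its coordinate and its precision are fixed by the seed and
    the first [k] measurements, before noise [k] enters. *)
Lemma mean_shift_predictable S i k (c c' : C) : c.1 = c'.1 ->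
  (forall j, (j < k)%N -> c.2 j = c'.2 j) ->
  mean_shift S i k c = mean_shift S i k c'.
Proof.
move=> c1 c2; congr (_ * Num.sqrt _); rewrite /data_of !dataE c1.
rewrite (eq_history _ _ _ c2).
by case: (history _ _ _ _ _) => //= h; case: ifP.
Qed.

Lemma drift_seed S i K c : (drift (mean_shift S i) K c).1 = c.1.
Proof. by elim: K. Qed.

Lemma drift_noise S i K j c : (K <= j)%N ->
  (drift (mean_shift S i) K c).2 j = c.2 j.
Proof.
elim: K => //= K IH Kj; rewrite gtn_eqF// IH//; exact: ltnW.
Qed.

(* Adding i to the support adds mu to the measurements of coordinate i, which
   amounts to shifting their normalized noise by mu * sqrt g. *)
Lemma history_drift (S : {set 'I_n}) i K j c : i \notin S -> (j <= K)%N ->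
  history p (signal mu (i |: S)) c.1 c.2 j =
  history p (signal mu S) (drift (mean_shift S i) K c).1
    (drift (mean_shift S i) K c).2 j.
Proof.
move=> iS; elim: K j => [|K IH] j; first by rewrite leqn0 => /eqP ->.
rewrite drift_seed leq_eqVlt => /predU1P[->|]; last first.
  rewrite ltnS => jK; rewrite (IH j jK) drift_seed; apply: eq_history => l lj /=.
  by rewrite ltn_eqF// (leq_trans lj).
have HK : history p (signal mu S) c.1 (drift (mean_shift S i) K.+1 c).2 K =
    history p (signal mu S) c.1 (drift (mean_shift S i) K c).2 K.
  by apply: eq_history => l lK /=; rewrite ltn_eqF.
rewrite [LHS]/= [RHS]/= -/(drift (mean_shift S i) K.+1 c) HK.
rewrite (IH K (leqnn K)) drift_seed.
(* This trivial equation exposes the shift at step [K], so that the case analysis on the history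
   also computes its value. *)
have := erefl (mean_shift S i K (drift (mean_shift S i) K c)).
rewrite {1}/mean_shift /data_of dataE drift_seed.
case: (history _ _ _ _ _) => // h; case: ifP => // _.
set a := coordinate _ _; set g := precision _ _ => /=.
rewrite /precision_at /= /precision_of /= eqxx => <-.
have g0 : 0 < g by exact: precision_gt0.
have sg0 : Num.sqrt g != 0 by rewrite gt_eqF// sqrtr_gt0.
congr (Some [tuple of rcons h (_, _, _)]).
rewrite drift_noise// /signal !inE val_eqE; case: (eqVneq a i) => [ai|ai] /=.
  by rewrite ai (negbTE iS); field.
by rewrite sqrtr0 mulr0 addr0.
Qed.

Lemma data_of_drift (S : {set 'I_n}) i K k c : i \notin S -> (k < K)%N ->
  data_of (i |: S) c k = data_of S (drift (mean_shift S i) K c) k.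
Proof. by move=> iS kK; rewrite /data_of /data (history_drift _ iS kK). Qed.

(** Events depending on finitely many measurements: an algebra generating all events. One
    implication suffices, since [D] and [D'] can be exchanged. *)
Definition finite_horizon (B : set (data_space R)) :=
  measurable B /\ exists K : nat, forall D D' : data_space R,
    (forall k, (k < K)%N -> D k = D' k) -> B D -> B D'.

Lemma finite_horizonC : setC_closed finite_horizon.
Proof.
move=> B [mB [K BK]]; split; first exact: measurableC.
exists K => D D' DD' nBD BD'; apply: nBD; apply: (BK D') => // k kK.
by rewrite DD'.
Qed.

Lemma finite_horizonU : setU_closed finite_horizon.
Proof.
move=> A B [mA [K AK]] [mB [K' BK']]; split; first exact: measurableU.
exists (maxn K K') => D D' DD' [AD|BD]; [left|right].
  by apply: AK AD => k kK; rewrite DD'// leq_max kK.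
by apply: BK' BD => k kK; rewrite DD'// leq_max kK orbT.
Qed.

Lemma measurable_finite_horizon :
  measurable `<=` <<s finite_horizon >>.
Proof.
apply: sub_sigma_algebra2 => _ [k [B [mB ->]]]; split.
  by apply: sub_sigma_algebra; exists k, B.
by exists k.+1 => D D' DD' [y Dy By]; exists y => //; rewrite -DD'.
Qed.

Local Open Scope ereal_scope.
Notation N01 := (normal_prob (0:R)%R (1:R)%R).
Variable nu : probability C R.
Hypothesis nu_cylinder : forall (K : nat) (B : set T) (A : nat -> set R),
  measurable B -> (forall j, measurable (A j)) ->
  nu (cylinder K B A) = nu (cylinder 0 B A) * \prod_(j < K) N01 (A j).

(** Written as a series of expectations, so that it dominates the finite sums of [testing_bound]
    uniformly in the horizon. *)
Definition precision_spent (S : {set 'I_n}) (i : 'I_n) : \bar R :=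
  \sum_(0 <= k <oo) \int[nu]_c (oapp (precision_at i) 0%R (data_of S c k))%:E.

(** For an event of finite horizon this is [testing_bound] with the shifts [mean_shift S i]. A
    general [A] is approximated by such an event up to an arbitrary [e]. *)
Lemma two_point_bound (S : {set 'I_n}) (i : 'I_n) (a : R)
    (A : set (data_space R)) :
  i \notin S -> measurable A -> (0 <= a)%R -> precision_spent S i < +oo ->
  (expR (- a) / 2 * (1 + a))%:E <=
  nu (data_of S @^-1` A) + nu (data_of (i |: S) @^-1` (~` A)) +
  (expR (- a) / 4 * mu ^+ 2)%:E * precision_spent S i.
Proof.
move=> iS mA a0 spent_fin; apply/lee_addgt0Pr => e e0.
have mD S' (B : set (data_space R)) :
  measurable B -> measurable (data_of S' @^-1` B).
  by move=> mB; rewrite -[X in measurable X]setTI; exact: measurable_data_of.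
have mDS S' := @measurable_data_of S'.
(* Approximating in the sum of the two laws yields one event [B] that is close to [A] under both
   supports. *)
pose rho' : {measure set (data_space R) -> \bar R} :=
  measure_add (pushforward nu (data_of S)) (pushforward nu (data_of (i |: S))).
pose rho := rho' (mDS S) (mDS (i |: S)).
have rhoE B : rho B = nu (data_of S @^-1` B) + nu (data_of (i |: S) @^-1` B).
  exact: measure_addE.
have rho_fin : rho setT < +oo.
  rewrite rhoE; apply: lte_add_pinfty; rewrite ltey_eq fin_num_measure//; exact: mD.
have FA : <<s finite_horizon >> A by exact: measurable_finite_horizon.
have F0 : finite_horizon set0 by split => //; exists 0%N.
have [_ /(_ _ e0)[B [mB [K BK]] BA]] := algebra_approximation rho_fin F0
  finite_horizonC finite_horizonU (fun B (FB : finite_horizon B) => FB.1) FA.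
have mBA : measurable (B `+` A) by apply: measurableU; exact: measurableD.
have nu_le (X Y Z : set (data_space R)) S' : measurable X -> measurable Y ->
    measurable Z -> X `<=` Y `|` Z ->
    nu (data_of S' @^-1` X) <= nu (data_of S' @^-1` Y) + nu (data_of S' @^-1` Z).
  move=> mX mY mZ XYZ; apply: le_trans (measureU2 _ (mD S' _ mY) (mD S' _ mZ)).
  apply: le_measure; rewrite ?inE; [exact: mD| |by move=> c /XYZ].
  by apply: measurableU; exact: mD.
have BAS : nu (data_of S @^-1` B) <=
    nu (data_of S @^-1` A) + nu (data_of S @^-1` (B `+` A)).
  apply: nu_le => // D BD; have [AD|nAD] := pselect (A D); first by left.
  by right; left.
have BAS' : nu (data_of (i |: S) @^-1` (~` B)) <=
    nu (data_of (i |: S) @^-1` (~` A)) + nu (data_of (i |: S) @^-1` (B `+` A)).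
  apply: nu_le => //; [exact: measurableC|exact: measurableC|move=> D nBD].
  by have [AD|nAD] := pselect (A D); [right; right|left].
have sqE j : \int[nu]_c (mean_shift S i j c ^+ 2)%:E =
    (mu ^+ 2)%:E * \int[nu]_c (oapp (precision_at i) 0%R (data_of S c j))%:E.
  rewrite -ge0_integralZl//; last 3 first.
  - apply/measurable_EFinP.
    exact: (measurableT_comp (measurable_oapp_data j (@measurable_precision_at R n i)) (mDS S)).
  - by move=> c _; rewrite lee_fin data_precision_at_ge0.
  - by rewrite lee_fin sqr_ge0.
  apply: eq_integral => c _; rewrite /mean_shift exprMn sqr_sqrtr//.
  exact: data_precision_at_ge0.
have sum_sq : \sum_(j < K) \int[nu]_c (mean_shift S i j c ^+ 2)%:E <=
    (mu ^+ 2)%:E * precision_spent S i.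
  under eq_bigr do rewrite sqE.
  rewrite -ge0_sume_distrr; last first.
    by move=> j _; apply: integral_ge0 => c _; rewrite lee_fin data_precision_at_ge0.
  rewrite lee_wpmul2l ?lee_fin ?sqr_ge0//.
  rewrite -(big_mkord xpredT (fun j => \int[nu]_c (oapp (precision_at i) 0%R (data_of S c j))%:E)).
  apply: nneseries_lim_ge => j _ _.
  by apply: integral_ge0 => c _; rewrite lee_fin data_precision_at_ge0.
have spent0 : 0 <= precision_spent S i.
  apply: nneseries_ge0 => j _ _.
  by apply: integral_ge0 => c _; rewrite lee_fin data_precision_at_ge0.
have := testing_bound nu_cylinder (@measurable_mean_shift S i)
  (@mean_shift_ge0 S i) (@mean_shift_predictable S i) (K := K) (mD S _ mB) a0.
(* Up to the horizon [K] of [B], the data of the drifted noise under [S] are those of the original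
   noise under [i |: S]. *)
have -> : drift (mean_shift S i) K @^-1` (~` (data_of S @^-1` B)) =
    data_of (i |: S) @^-1` (~` B).
  apply/seteqP; split => c nB BD; apply: nB.
    by apply: BK BD => k kK; exact: data_of_drift.
  by apply: BK BD => k kK; rewrite (data_of_drift _ iS kK).
move=> /(_ (le_lt_trans sum_sq _))-/(_ _)/le_trans; apply.
  by rewrite -ge0_fin_numE ?fin_numM ?mule_ge0 ?lee_fin ?sqr_ge0// ge0_fin_numE.
rewrite rhoE in BA.
apply: (@le_trans _ _ ((nu (data_of S @^-1` A) + nu (data_of S @^-1` (B `+` A))) +
  (nu (data_of (i |: S) @^-1` (~` A)) + nu (data_of (i |: S) @^-1` (B `+` A))) +
  (expR (- a) / 4)%:E * ((mu ^+ 2)%:E * precision_spent S i))).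
  apply: leeD; first exact: leeD.
  by rewrite lee_wpmul2l// lee_fin divr_ge0// expR_ge0.
rewrite muleA -EFinM addeACA [leRHS]addeAC.
by apply: leeD => //; apply: leeD.
Qed.

End ChangeOfSupport.

(** * Laws, precision and error *)

Section SeedNoise.
Context (R : realType) (d dT : measure_display) (Omega : measurableType d)
  (T : measurableType dT) (P : probability Omega R) (U : {RV P >-> T})
  (W : nat -> {RV P >-> R}).

Definition seed_noise (omega : Omega) : noise_space R T :=
  (U omega, fun j => W j omega).

Lemma measurable_seed_noise : measurable_fun setT seed_noise.
Proof. by apply: measurable_fun_noise_space. Qed.

HB.instance Definition _ :=
  isMeasurableFun.Build _ _ _ _ seed_noise measurable_seed_noise.

Lemma seed_noise_cylinder (K : nat) (B : set T) (A : nat -> set R) :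
  noise_model U W -> measurable B -> (forall j, measurable (A j)) ->
  (distribution P seed_noise (cylinder K B A) =
   distribution P seed_noise (cylinder 0 B A) *
     \prod_(j < K) normal_prob 0 1 (A j))%E.
Proof.
move=> [Wnormal indep] mB mA.
have cylE k : distribution P seed_noise (cylinder k B A) =
    P (U @^-1` B `&` \bigcap_(j in [set j | (j < k)%N]) (W j @^-1` A j)).
  congr (P _); apply/seteqP; split => w /= [BU H]; split => // j jk; exact: H.
rewrite !cylE !indep// big_ord0 mule1; congr (_ * _)%E.
by apply: eq_bigr => j _; rewrite -(Wnormal j _ (mA j)).
Qed.

End SeedNoise.

Section Budget.
Local Open Scope ereal_scope.
Context (R : realType) (n : nat) (dT : measure_display) (T : measurableType dT).
Variables (p : procedure R n T) (mu : R).
Notation C := (noise_space R T).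
Variable nu : probability C R.

(** Tonelli exchanges the sums with the integral; the bound then holds measurement by
    measurement. *)
Lemma sum_precision_spent_le (S A : {set 'I_n}) :
  \sum_(i in A) precision_spent p mu nu S i <=
  \int[nu]_c total_precision (data_of p mu S c).
Proof.
have mo (g : measurement R -> R) k : measurable_fun setT g ->
    measurable_fun setT (fun c : C => (oapp g 0%R (data_of p mu S c k))%:E).
  move=> mg; apply/measurable_EFinP.
  exact: (measurableT_comp (measurable_oapp_data k mg) (measurable_data_of p mu S)).
have mp : measurable_fun setT (@precision_of R) by exact: measurableT_comp.
have mpi i := @measurable_precision_at R n i.
rewrite /total_precision integral_nneseries//; last 2 first.
- by move=> k; exact: mo.
- by move=> k c _; rewrite lee_fin data_precision_ge0.
rewrite /precision_spent -nneseries_sum; last first.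
  by move=> i k _; apply: integral_ge0 => c _; rewrite lee_fin data_precision_at_ge0.
apply: lee_nneseries => k _.
  by move=> _; apply: sume_ge0 => i _;
    apply: integral_ge0 => c _; rewrite lee_fin data_precision_at_ge0.
rewrite -big_enum -ge0_integral_sum//; last 2 first.
- by move=> i; exact: mo.
- by move=> i c _; rewrite lee_fin data_precision_at_ge0.
apply: ge0_le_integral => //.
- by move=> c _; apply: sume_ge0 => i _; rewrite lee_fin data_precision_at_ge0.
- by apply: emeasurable_sum => i; exact: mo.
- exact: mo.
- by move=> c _; rewrite big_enum sumEFin lee_fin; exact: sum_precision_at_le.
Qed.

Variable Shat : data_space R -> {set 'I_n}.
Hypothesis mShat : measurable_estimator Shat.

Lemma measurable_selection (i : 'I_n) :
  measurable [set D : data_space R | i \in Shat D].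
Proof.
rewrite (_ : [set _ | _] = \big[setU/set0]_(S : {set 'I_n} | i \in S)
  (Shat @^-1` [set S])).
  by apply: bigsetU_measurable => S _; exact: mShat.
apply/seteqP; split => [D iD|D].
  by rewrite (bigD1 (Shat D))//=; left.
by elim/big_ind: _ => // [X Y HX HY [/HX|/HY]//|S iS /= ->].
Qed.

(** The size of the symmetric difference is a sum of indicators over all coordinates, of which only
    those in [A] are kept. *)
Lemma sum_error_le d (Omega : measurableType d) (P : {measure set Omega -> \bar R})
    (X : Omega -> data_space R) (S A : {set 'I_n}) :
  measurable_fun setT X ->
  \sum_(i in A) P (X @^-1` [set D | i \in symdiff (Shat D) S]) <=
  \int[P]_w (#|symdiff (Shat (X w)) S|%:R)%:E.
Proof.
move=> mX.
have mE i : measurable (X @^-1` [set D | i \in symdiff (Shat D) S]).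
  rewrite -[X in measurable X]setTI; apply: mX => //.
  rewrite (_ : [set _ | _] = if i \in S then ~` [set D : data_space R | i \in Shat D]
      else [set D | i \in Shat D]); last first.
    apply/seteqP; split => D /=; rewrite /symdiff !inE; case: (i \in S) => /=.
    - by rewrite andbT => /negP.
    - by rewrite andbF orbF.
    - by rewrite andbT => /negP.
    - by rewrite andbF orbF.
  by case: ifP => _; [apply: measurableC|]; exact: measurable_selection.
have cardE c : (#|symdiff (Shat (X c)) S|%:R)%:E =
    \sum_(i : 'I_n) (\1_(X @^-1` [set D | i \in symdiff (Shat D) S]) c)%:E :> \bar R.
  rewrite sumEFin; congr EFin; rewrite -sum1_card natr_sum big_mkcond/=.
  apply: eq_bigr => i _; rewrite indicE; case: ifPn => iD.
    by rewrite mem_set.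
  by rewrite memNset//; exact/negP.
under eq_integral do rewrite cardE.
rewrite ge0_integral_sum//; last first.
  by move=> i; exact/measurable_EFinP/measurable_indic.
rewrite [leRHS](bigID (mem A))/= -[leLHS]adde0; apply: leeD.
  by apply: lee_sum => i _; rewrite integral_indic// setIT.
by apply: sume_ge0 => i _; apply: integral_ge0 => c _; rewrite lee_fin.
Qed.

End Budget.

(** * Averaging over supports *)

(** For fixed [i], adding [i] is a bijection from the [k]-sets avoiding [i] to the [k.+1]-sets
    containing it; its inverse removes [i]. *)
Lemma sum_add_element (V : nmodType) (T : finType) (k : nat)
    (F : {set T} -> T -> V) :
  \sum_(S : {set T} | #|S| == k) \sum_(i in (~: S)%SET) F (i |: S)%SET i =
  \sum_(S : {set T} | #|S| == k.+1) \sum_(i in S) F S i.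
Proof.
rewrite (exchange_big_dep predT)//= [RHS](exchange_big_dep predT)//=.
apply: eq_bigr => i _.
rewrite (reindex_onto (fun S => S :\ i)%SET (fun S => i |: S)%SET)/=; last first.
  by move=> S; rewrite inE => /andP[_ iS]; rewrite finset.setU1K.
apply: eq_big => S.
  rewrite !inE eqxx/= andbT; have [iS|iS] := boolP (i \in S).
    by rewrite finset.setD1K// eqxx andbT (cardsD1 i S) iS add1n eqSS andbT.
  rewrite andbF; apply/negbTE; rewrite negb_and; apply/orP; right.
  by apply: contra iS => /eqP <-; rewrite finset.setU11.
by move=> /andP[_ /eqP ->].
Qed.

(** Here [k] is the sparsity [s]. The hypothesis is solved for the exponent by taking logarithms,
    after weakening [n - s + 1] to [n - s]. *)
Lemma sqrt_bound_le (R : realType) (n k : nat) (m mu eps : R) : (k < n)%N ->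
  0 < m -> 0 < mu -> 0 < eps -> (0 < k)%N ->
  k%:R * (n - k).+1%:R * expR (- (mu ^+ 2 * m / (2 * (n - k).+1%:R))) <=
    2 * (n + 1)%:R * eps ->
  Num.sqrt (2 * (n - k)%:R / m *
    (ln k%:R + ln ((n - k)%:R / (n + 1)%:R) + ln (1 / (2 * eps)))) <= mu.
Proof.
move=> kn m0 mu0 eps0 k0 H.
set N := (n - k)%N in H *.
have Nn : (0 < N)%N by rewrite subn_gt0.
have N0 : 0 < N%:R :> R by rewrite ltr0n.
have n0 : 0 < (n + 1)%:R :> R by rewrite ltr0n addn1.
have kR0 : 0 < k%:R :> R by rewrite ltr0n.
(* It is enough to compare the radicand with [mu ^+ 2]; a negative radicand, the void case, has root
   0 and needs no separate treatment. *)
rewrite -[leRHS](ger0_norm (ltW mu0)) -sqrtr_sqr; apply: ler_wsqrtr.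
rewrite -!lnM ?posrE ?divr_gt0 ?mulr_gt0//.
set a := (_ / _) in H.
set X := (X in ln X).
have X0 : 0 < X.
  by apply: mulr_gt0; [apply: mulr_gt0 => //; exact: divr_gt0|apply: divr_gt0 => //; exact: mulr_gt0].
have aN : a <= mu ^+ 2 * m / (2 * N%:R).
  rewrite /a ler_pM2l ?mulr_gt0 ?exprn_gt0// lef_pV2 ?posrE ?mulr_gt0 ?ltr0n//.
  by rewrite ler_pM2l// ler_nat.
have XA : X <= expR a.
  have Ha : expR a * expR (- a) = 1 by rewrite -expRD subrr expR0.
  have : k%:R * N%:R <= 2 * (n + 1)%:R * eps * expR a.
    apply: (@le_trans _ _ (k%:R * N.+1%:R * expR (- a) * expR a)).
      rewrite -mulrA [_ * expR a]mulrC Ha mulr1 ler_pM2l// ler_nat.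
      exact: leqnSn.
    by rewrite ler_pM2r ?expR_gt0.
  move=> h; rewrite /X.
  have -> : k%:R * (N%:R / (n + 1)%:R) * (1 / (2 * eps)) =
      k%:R * N%:R / (2 * (n + 1)%:R * eps) :> R.
    by field; rewrite !gt_eqF.
  by rewrite ler_pdivrMr ?mulr_gt0// [leRHS]mulrC.
have lnX : ln X <= a by rewrite -[leRHS]expRK ler_ln ?posrE ?expR_gt0.
apply: (@le_trans _ _ (2 * N%:R / m * (mu ^+ 2 * m / (2 * N%:R)))).
  by rewrite ler_pM2l ?divr_gt0 ?mulr_gt0// (le_trans lnX).
by rewrite le_eqVlt; apply/orP; left; apply/eqP; field; rewrite !gt_eqF.
Qed.

(** Here [alpha] stands for false inclusions, [beta] for false exclusions. Summing over all [k]-sets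
    turns the second kind into a sum over [k.+1]-sets, and Pascal's rule adds the two binomials that
    multiply [eps]. *)
Lemma averaged_bound (R : realType) (n k : nat) (b eps : R)
    (alpha beta : {set 'I_n} -> 'I_n -> R) : (k < n)%N ->
  (forall S : {set 'I_n}, #|S| = k ->
    (n - k)%:R * b / 2 <=
    \sum_(i in (~: S)%SET) (alpha S i + beta (i |: S)%SET i)) ->
  (forall S : {set 'I_n}, #|S| = k -> \sum_(i in (~: S)%SET) alpha S i <= eps) ->
  (forall S : {set 'I_n}, #|S| = k.+1 -> \sum_(i in S) beta S i <= eps) ->
  k.+1%:R * (n - k)%:R * b <= 2 * (n + 1)%:R * eps.
Proof.
move=> kn lower alpha_le beta_le.
have cardk j : (\sum_(S : {set 'I_n} | #|S| == j) 1)%N = 'C(n, j).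
  rewrite -[in RHS](card_ord n) -card_draws -sum1_card.
  by apply: eq_bigl => S; rewrite inE.
have sumk j (x : R) : \sum_(S : {set 'I_n} | #|S| == j) x = 'C(n, j)%:R * x.
  by rewrite -cardk sumr_const -sum1_card mulr_natl.
have : 'C(n, k)%:R * ((n - k)%:R * b / 2) <= 'C(n.+1, k.+1)%:R * eps.
  rewrite binS natrD mulrDl addrC -!sumk.
  apply: (@le_trans _ _ (\sum_(S : {set 'I_n} | #|S| == k)
      \sum_(i in (~: S)%SET) (alpha S i + beta (i |: S)%SET i))).
    by apply: ler_sum => S /eqP; exact: lower.
  under eq_bigr do rewrite big_split/=.
  rewrite big_split/= sum_add_element lerD//.
    by apply: ler_sum => S /eqP; exact: alpha_le.
  by apply: ler_sum => S /eqP; exact: beta_le.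
(* These two identities express both binomials through ['C(n, k.+1)], which then cancels. *)
have e1 : (n - k)%:R * 'C(n, k)%:R = k.+1%:R * 'C(n, k.+1)%:R :> R.
  by rewrite -!natrM mul_bin_left.
have e2 : (n + 1)%:R * 'C(n, k.+1)%:R = (n - k)%:R * 'C(n.+1, k.+1)%:R :> R.
  by rewrite -!natrM addn1 (mul_bin_down n.+1 k.+1).
have x0 : 0 < 'C(n, k.+1)%:R :> R by rewrite ltr0n bin_gt0.
have N0 : 0 < (n - k)%:R :> R by rewrite ltr0n subn_gt0.
move=> h; rewrite -(ler_pM2l x0).
have -> : 'C(n, k.+1)%:R * (2 * (n + 1)%:R * eps) =
    2 * (n - k)%:R * ('C(n.+1, k.+1)%:R * eps).
  transitivity (2 * eps * ((n + 1)%:R * 'C(n, k.+1)%:R)); first by ring.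
  by rewrite e2; ring.
apply: le_trans (ler_wpM2l _ h); last by rewrite mulr_ge0// ltW.
have -> : 2 * (n - k)%:R * ('C(n, k)%:R * ((n - k)%:R * b / 2)) =
  ((n - k)%:R * 'C(n, k)%:R) * ((n - k)%:R * b) by field.
by rewrite e1 le_eqVlt; apply/orP; left; apply/eqP; ring.
Qed.

Theorem proposition12 (R : realType) (n s : nat) (m mu eps : R)
    (d dT : measure_display) (Omega : measurableType d)
    (T : measurableType dT) (P : probability Omega R)
    (U : {RV P >-> T}) (W : nat -> {RV P >-> R})
    (p : procedure R n T)
    (Shat : (nat -> option (measurement R)) -> {set 'I_n}) :
  (1 <= s)%N -> (s < n)%N -> 0 < m -> 0 < mu -> 0 < eps ->
  noise_model U W ->
  (forall S : {set 'I_n}, S \in support_class n s ->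
     (expected_precision U W p mu S <= m%:E)%E) ->
  measurable_estimator Shat ->
  (forall S : {set 'I_n}, S \in support_class n s ->
     (expected_error U W p mu Shat S <= eps%:E)%E) ->
  Num.sqrt (2 * (n - s)%:R / m *
            (ln s%:R + ln ((n - s)%:R / (n + 1)%:R) + ln (1 / (2 * eps))))
    <= mu.
Proof.
(* With [s = k.+1], a [k]-set and its one-element extensions all lie in the class. *)
case: s => // k _ kn m0 mu0 eps0 noise budget mShat risk.
have mu_ge0 := ltW mu0.
have classk (S : {set 'I_n}) : #|S| = k -> S \in support_class n k.+1.
  by move=> Sk; rewrite inE Sk subn1 eqxx.
have classk1 (S : {set 'I_n}) : #|S| = k.+1 -> S \in support_class n k.+1.
  by move=> Sk; rewrite inE Sk eqxx orbT.
pose nu := distribution P (seed_noise U W).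
have nuE := fun K B A mB mA => @seed_noise_cylinder R d dT Omega T P U W K B A noise mB mA.
have mdata (S : {set 'I_n}) : measurable_fun setT (data_of p mu S)
  by exact: measurable_data_of.
have mdata_at (S : {set 'I_n}) : measurable_fun setT (fun w => data_of p mu S (seed_noise U W w)).
  exact: (measurableT_comp (mdata S) (measurable_seed_noise U W)).
have mtotal (S : {set 'I_n}) : measurable_fun setT (fun c => total_precision (data_of p mu S c)).
  apply: ge0_emeasurable_sum => [j c _ _|j _].
    by rewrite lee_fin data_precision_ge0.
  apply/measurable_EFinP.
  apply: (measurableT_comp (measurable_oapp_data j _) (mdata S)).
  exact: measurableT_comp.
have spent_le (S : {set 'I_n}) (A : {set 'I_n}) : S \in support_class n k.+1 ->
    (\sum_(i in A) precision_spent p mu nu S i <= m%:E)%E.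
  move=> Sc; apply: le_trans (sum_precision_spent_le p mu nu S A) _.
  apply: le_trans (budget S Sc); rewrite ge0_integral_distribution//.
  by move=> c; apply: nneseries_ge0 => j _ _; rewrite lee_fin data_precision_ge0.
have spent_ge0 (S : {set 'I_n}) i : (0 <= precision_spent p mu nu S i)%E.
  apply: nneseries_ge0 => j _ _; apply: integral_ge0 => c _.
  by rewrite lee_fin data_precision_at_ge0.
pose sel i := [set D : data_space R | i \in Shat D].
have msel i : measurable (sel i) by exact: measurable_selection.
have mpre (S : {set 'I_n}) (B : set (data_space R)) :
  measurable B -> measurable (data_of p mu S @^-1` B).
  by move=> mB; rewrite -[X in measurable X]setTI; exact: mdata.
pose alpha (S : {set 'I_n}) i := fine (nu (data_of p mu S @^-1` sel i)).
pose beta (S : {set 'I_n}) i := fine (nu (data_of p mu S @^-1` (~` sel i))).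
have alphaE (S : {set 'I_n}) i : (alpha S i)%:E = nu (data_of p mu S @^-1` sel i).
  by rewrite fineK// fin_num_measure//; exact: mpre.
have betaE (S : {set 'I_n}) i : (beta S i)%:E = nu (data_of p mu S @^-1` (~` sel i)).
  by rewrite fineK// fin_num_measure//; apply: mpre; exact: measurableC.
have err_le (S : {set 'I_n}) (A : {set 'I_n}) : S \in support_class n k.+1 ->
    (\sum_(i in A) nu (data_of p mu S @^-1` [set D | i \in symdiff (Shat D) S])
      <= eps%:E)%E.
  move=> Sc; apply: le_trans (risk S Sc).
  rewrite /expected_error expectation.unlock.
  exact: (sum_error_le mShat P S A (mdata_at S)).
have alpha_le (S : {set 'I_n}) : #|S| = k -> \sum_(i in (~: S)%SET) alpha S i <= eps.
  move=> Sk; rewrite -lee_fin -sumEFin; apply: le_trans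
    (err_le S (~: S)%SET (classk S Sk)).
  apply: lee_sum => i; rewrite inE => iS; rewrite alphaE.
  rewrite (_ : [set D | i \in symdiff (Shat D) S] = sel i)//.
  by apply/seteqP; split => D; rewrite /sel /symdiff /= !inE iS (negbTE iS) andbF orbF.
have beta_le (S : {set 'I_n}) : #|S| = k.+1 -> \sum_(i in S) beta S i <= eps.
  move=> Sk; rewrite -lee_fin -sumEFin; apply: le_trans
    (err_le S S (classk1 S Sk)).
  apply: lee_sum => i iS; rewrite betaE.
  rewrite (_ : [set D | i \in symdiff (Shat D) S] = ~` sel i)//.
  by apply/seteqP; split => D; rewrite /sel /symdiff /= !inE iS /= andbT => /negP.
apply: sqrt_bound_le => //.
have kn' : (k < n)%N by exact: ltnW.
have Nk : (n - k.+1).+1 = (n - k)%N by rewrite subnSK.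
(* [N] counts the elements outside [S], and [a] bounds the average of [mu^2 G_i / 2] over them.
   Since [(1 + x - a) e^-x] is largest at [x = a], this is also the best exponent. *)
rewrite Nk; set N := (n - k)%N; set a := mu ^+ 2 * m / (2 * N%:R).
have N0 : 0 < N%:R :> R by rewrite ltr0n subn_gt0.
have a0 : 0 <= a by rewrite divr_ge0 ?mulr_ge0 ?sqr_ge0// ltW.
apply: (@averaged_bound R n k (expR (- a)) eps alpha beta) => // S Sk.
have cardC : #|(~: S)%SET| = N by rewrite cardsCs finset.setCK card_ord Sk.
have two_point i : i \in (~: S)%SET ->
    ((expR (- a) / 2 * (1 + a))%:E <= (alpha S i + beta (i |: S)%SET i)%:E +
      (expR (- a) / 4 * mu ^+ 2)%:E * precision_spent p mu nu S i)%E.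
  rewrite inE => iS; rewrite EFinD alphaE betaE.
  apply: (two_point_bound mu_ge0 nuE iS (msel i) a0).
  (* The budget restricted to coordinate [i] gives finiteness. *)
  have := spent_le S [set i]%SET (classk S Sk); rewrite big_set1.
  by move/le_lt_trans; apply; rewrite ltry.
have := lee_sum (index_enum 'I_n) two_point.
rewrite big_split/= -ge0_sume_distrr// !sumEFin sumr_const cardC.
move=> /le_trans/(_ (leeD2l _ (lee_wpmul2l _ (spent_le S (~: S)%SET (classk S Sk))))).
rewrite lee_fin mulr_ge0 ?divr_ge0 ?expR_ge0 ?sqr_ge0// => /(_ isT).
rewrite -EFinM -EFinD lee_fin -mulr_natr => H.
(* By the choice of [a], the precision term cancels the [a] in [1 + a], leaving [N e^-a / 2]. *)
have e1 : expR (- a) / 4 * mu ^+ 2 * m = N%:R * expR (- a) / 2 * a.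
  by rewrite /a; field; rewrite gt_eqF.
rewrite e1 in H; nra.
Qed.
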